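(* Let $k\ge1$, $n\ge2$, $m=kn+1$, $n'=n-1$, $m'=kn'+1$, and $D'\in\mathcal D_{m',n'}$. Suppose $\Phi^{-1}(D')$ is cut at a vertex (other than its endpoint) of rank $r<m'$ (rank in the $(m',n')$ system) as $\Phi^{-1}(D')=AB$, and let $D\in\mathcal D_{m,n}$ be defined by $\Phi^{-1}(D)=N\,B\,A\,E^k$ (a North step, then $B$, then $A$, then $k$ East steps). Then $\mathrm{cobounce}(D)=\mathrm{cobounce}(D')+r$; equivalently, $\mathrm{bounce}(D)=\mathrm{bounce}(D')+n'k-r$.
   Context: For coprime $m,n$, $\mathcal D_{m,n}$ is the set of lattice paths from $(0,0)$ to $(m,n)$ with unit North and East steps staying weakly above the segment from $(0,0)$ to $(m,n)$. The rank of $(x,y)$ is $ym-xn$. The sweep map $\Phi:\mathcal D_{m,n}\to\mathcal D_{m,n}$ sends $P$ to the path whose $i$-th step is North iff the step of $P$ with the $i$-th smallest starting rank is North; it is a bijection when $m=kn+1$ (and the path $NBAE^k$ above lies in $\mathcal D_{m,n}$). $\mathrm{area}(P)$ is the number of unit cells between $P$ and the main diagonal not cut by the diagonal. $\mathrm{bounce}(D):=\mathrm{area}(\Phi^{-1}(D))$, and for $D\in\mathcal D_{kn+1,n}$, $\mathrm{cobounce}(D):=k\binom n2-\mathrm{bounce}(D)$ (similarly with $n'$ for $D'$). *)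

(* Defs.v *)
From mathcomp Require Import all_boot all_order all_algebra.

Set Implicit Arguments.
Unset Strict Implicit.
Unset Printing Implicit Defensive.

Import Order.TTheory GRing.Theory Num.Theory.
Local Open Scope ring_scope.

(* A lattice path starting at (0,0) is the word of its unit steps. *)
Definition North : bool := true.
Definition East : bool := false.

Definition endpt (w : seq bool) : nat * nat :=
  (count_mem East w, count_mem North w).

Definition vertex (P : seq bool) (i : nat) : nat * nat := endpt (take i P).

Definition rank (m n : nat) (p : nat * nat) : int :=
  p.2%:Z * m%:Z - p.1%:Z * n%:Z.

(* The half-plane weakly above the line through (0,0) and (m,n) is           *)
(* {rank >= 0}; it is convex, so testing the vertices of P is enough.        *)
Definition dyck (m n : nat) : pred (seq bool) := fun P =>
  (endpt P == (m, n)) &&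
  all (fun i => 0 <= rank m n (vertex P i)) (iota 0 (size P).+1).

(* For coprime m, n the starting ranks of the steps of a path in dyck m n    *)
(* are pairwise distinct, so the sorted list of step indices is unambiguous. *)
Definition sweep (m n : nat) (P : seq bool) : seq bool :=
  [seq nth East P i
     | i <- sort (fun i j => rank m n (vertex P i) <= rank m n (vertex P j))
                 (iota 0 (size P))].

(* The preimage of D in dyck m n under the sweep map, which is a bijection   *)
(* of dyck m n for m = k n + 1. The junk value [::], returned when there is  *)
(* no preimage, is not in dyck m n unless m = n = 0.                         *)
Definition sweep_inv (m n : nat) (D : seq bool) : seq bool :=
  if [pick P : (m + n).-tuple bool | dyck m n P && (sweep m n P == D)]
    is Some P then tval P else [::].

(* The cell (x, y) is the square [x, x+1] * [y, y+1]; it lies below P when   *)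
(* the North step of P from height y to y+1 has abscissa at most x.          *)
Definition below (P : seq bool) (x y : nat) : bool :=
  has (fun i => [&& nth East P i == North,
                    (vertex P i).2 == y & ((vertex P i).1 <= x)%N])
      (iota 0 (size P)).

(* A cell above the diagonal is not cut by it when its corner of least rank, *)
(* the south-east corner (x+1, y), is still weakly above the diagonal.       *)
Definition area (m n : nat) (P : seq bool) : nat :=
  #|[set c : 'I_m * 'I_n |
      below P c.1 c.2 && (0 <= rank m n ((c.1).+1, c.2 : nat))]|.

Definition bounce (m n : nat) (D : seq bool) : nat :=
  area m n (sweep_inv m n D).

Definition cobounce (k n : nat) (D : seq bool) : int :=
  (k * 'C(n, 2))%N%:Z - (bounce (k * n + 1) n D)%:Z.

(* Main.v *)
Require Import Defs.
From mathcomp Require Import all_boot all_order all_algebra.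
From mathcomp Require Import zify.

(** For [m = k n + 1] the row of height [y] of a Dyck path whose North step has
    abscissa [x] contributes exactly [k y - x] cells to the area. Hence the area
    is [k * 'C(n, 2)] minus the number of pairs (East step, later North step) of
    the word, i.e. cobounce counts the inversions of the preimage under the
    sweep map. Passing from [A B] to [N B A E^k] trades the pairs
    (East in A, North in B) for the pairs (East in B, North in A), and the
    difference of these two numbers is the rank of the endpoint of [A]. *)

Local Open Scope ring_scope.

Fixpoint inversions (w : seq bool) : nat :=
  if w is b :: w' then ((if b then 0 else count_mem North w') + inversions w')%N
  else 0%N.

(* Abscissa of the North step leaving height [y]; it is a junk value when
   [count_mem North w <= y]. *)
Fixpoint north_abscissa (w : seq bool) (y : nat) : nat :=
  match w, y with
  | [::], _ => 0
  | true :: _, 0 => 0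
  | true :: w', y'.+1 => north_abscissa w' y'
  | false :: w', _ => (north_abscissa w' y).+1
  end.

Lemma inversions_cat (u v : seq bool) :
  inversions (u ++ v) =
    (inversions u + inversions v + count_mem East u * count_mem North v)%N.
Proof.
elim: u => [|b u IHu] /=; first by rewrite mul0n addn0.
rewrite IHu count_cat; case: b => /=; rewrite /East /North /=; lia.
Qed.

Lemma inversions_cat_nseq_East (w : seq bool) (k : nat) :
  inversions (w ++ nseq k East) = inversions w.
Proof.
rewrite inversions_cat count_nseq /= mul0n muln0 addn0.
by elim: k => [|k IHk] /=; rewrite ?addn0 // count_nseq /= mul0n.
Qed.

(** The abscissa of a North step is the number of East steps before it, that is, the number of
    inversions ending at that step. *)
Lemma sum_north_abscissa (w : seq bool) :
  (\sum_(y < count_mem North w) north_abscissa w y)%N = inversions w.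
Proof.
elim: w => [|[] w IHw]; first by rewrite big_ord0.
- by rewrite /= add1n big_ord_recl /= add0n -IHw; apply: eq_bigr.
- rewrite /= add0n -IHw.
  rewrite (eq_bigr (fun y : 'I__ => (1 + north_abscissa w y)%N)) //.
  by rewrite big_split /= big_const_ord iter_addn_0 mul1n.
Qed.

Lemma belowE (w : seq bool) (x y : nat) : (y < count_mem North w)%N ->
  below w x y = (north_abscissa w y <= x)%N.
Proof.
elim: w x y => [//|b w IHw] x y lt_y.
rewrite /below /= -[1%N]addn0 iotaDl has_map /vertex /endpt /=.
case: b lt_y => /= lt_y.
- case: y lt_y => [//|y] lt_y /=.
  rewrite -(IHw x y); last by move: lt_y; rewrite add1n ltnS.
  by apply: eq_has => i /=; rewrite add0n add1n eqSS.
- case: x => [|x].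
  + by apply/hasPn => i _ /=; rewrite add1n ltn0 !andbF.
  + by rewrite ltnS -(IHw x y).
Qed.

Lemma vertex_north_abscissa (w : seq bool) (y : nat) :
  (y < count_mem North w)%N ->
  exists2 i, (i < size w)%N & vertex w i = (north_abscissa w y, y).
Proof.
elim: w y => [//|[] w IHw] y /= lt_y.
- case: y lt_y => [|y] lt_y; first by exists 0%N.
  have [i lt_i] : exists2 i, (i < size w)%N & vertex w i = (north_abscissa w y, y).
    by apply: IHw; move: lt_y; rewrite add1n ltnS.
  by rewrite /vertex /endpt => -[Ex Ey]; exists i.+1; rewrite //= Ex Ey.
- have [i lt_i] := IHw y lt_y.
  by rewrite /vertex /endpt => -[Ex Ey]; exists i.+1; rewrite //= Ex Ey.
Qed.

(** Nonnegative rank at the start [(x, y)] of the North step reads [x * n <= k * y * n + y], and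
    [y < n] absorbs the last term. *)
Lemma dyck_north_abscissa (k n : nat) (P : seq bool) (y : nat) :
  dyck (k * n + 1) n P -> (y < n)%N -> (north_abscissa P y <= k * y)%N.
Proof.
move=> /andP[/eqP[_ cN] /allP Pge0] lt_y.
have [i lt_i Ei] : exists2 i, (i < size P)%N
    & vertex P i = (north_abscissa P y, y).
  by apply: vertex_north_abscissa; rewrite cN.
have := Pge0 i; rewrite mem_iota ltnS (ltnW lt_i) => /(_ isT).
rewrite Ei /rank /=; nia.
Qed.

Lemma card_ord_between (m a b : nat) :
  (\sum_(x < m) (a <= x < b) = minn b m - a)%N.
Proof.
elim: m => [|m IHm]; first by rewrite big_ord0 minn0 sub0n.
by rewrite big_ord_recr /= IHm; lia.
Qed.

Lemma area_inversions (k n : nat) (P : seq bool) : dyck (k * n + 1) n P ->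
  (area (k * n + 1) n P + inversions P = k * 'C(n, 2))%N.
Proof.
move=> dP; have /andP[/eqP[_ cN] _] := dP.
have -> : area (k * n + 1) n P = (\sum_(y < n) (k * y - north_abscissa P y))%N.
  rewrite /area cardsE -sum1_card big_mkcond /=.
  pose F (x : 'I_(k * n + 1)) (y : 'I_n) : nat :=
    below P x y && (0 <= rank (k * n + 1) n (x.+1, y : nat)).
  rewrite (eq_bigr (fun c => F c.1 c.2)) => [|c _]; last first.
    by rewrite unfold_in /F; case: (_ && _).
  rewrite -(pair_bigA _ F) /= exchange_big; apply: eq_bigr => y _ /=.
  have lt_y := ltn_ord y.
  (* The [minn] is just [k * y]; it puts the row length in the form of a count over the columns
     [x < k * n + 1]. *)
  have -> : (k * y - north_abscissa P y =
             minn (k * y) (k * n + 1) - north_abscissa P y)%N by nia.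
  rewrite -card_ord_between; apply: eq_bigr => x _.
  rewrite /F belowE ?cN //.
  suff -> : (0 <= rank (k * n + 1) n (x.+1, y : nat)) = (x < k * y)%N by [].
  by rewrite /rank /=; apply/idP/idP; nia.
(* [k * 'C(n, 2)] is the sum of [k * y] over [y < n], so rows are compared one by one; the truncated
   subtraction is exact by [dyck_north_abscissa]. *)
rewrite -sum_north_abscissa cN -big_split /= -bin2_sum big_mkord big_distrr /=.
by apply: eq_bigr => y _; rewrite subnK // (@dyck_north_abscissa k n).
Qed.

Lemma sweep_inv_dyck (m n : nat) (D : seq bool) :
  sweep_inv m n D <> [::] -> dyck m n (sweep_inv m n D).
Proof. by rewrite /sweep_inv; case: pickP => // P /andP[]. Qed.

Theorem theorem4p8 (k n m n' m' : nat) (r : int) (D' A B D : seq bool)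
  (hk : (1 <= k)%N) (hn : (2 <= n)%N)
  (hm : m = (k * n + 1)%N) (hn' : n' = (n - 1)%N) (hm' : m' = (k * n' + 1)%N)
  (hD' : dyck m' n' D')
  (hcut : sweep_inv m' n' D' = A ++ B)
  (hB : B <> [::])
  (hrank : rank m' n' (endpt A) = r)
  (hr : r < m'%:Z)
  (hD : dyck m n D)
  (hDdef : sweep_inv m n D = North :: B ++ A ++ nseq k East) :
  cobounce k n D = cobounce k n' D' + r
  /\ (bounce m n D)%:Z = (bounce m' n' D')%:Z + n'%:Z * k%:Z - r.
Proof.
have dP' : dyck m' n' (A ++ B).
  (* As [B] is nonempty, the preimage is not the junk value [[::]]. *)
  by rewrite -hcut; apply: sweep_inv_dyck; rewrite hcut; case: (A) hB.
have dP : dyck m n (North :: B ++ A ++ nseq k East).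
  by rewrite -hDdef; apply: sweep_inv_dyck; rewrite hDdef.
have area_P : (bounce m n D + inversions (B ++ A) = k * 'C(n, 2))%N.
  rewrite hm in dP *; rewrite -(@area_inversions k n _ dP) /bounce -hm hDdef /=.
  by rewrite catA inversions_cat_nseq_East.
have area_P' : (bounce m' n' D' + inversions (A ++ B) = k * 'C(n', 2))%N.
  rewrite hm' in dP' *; rewrite -(@area_inversions k n' _ dP').
  by rewrite /bounce -hm' hcut.
have inversions_swap : (inversions (B ++ A))%:Z = (inversions (A ++ B))%:Z + r.
  (* With [m' = eA + eB] and [n' = nA + nB], the products [nA * eA] cancel in the rank, leaving
     [nA * eB - eA * nB]. *)
  move: dP' => /andP[/eqP[] + + _]; rewrite !count_cat -hrank /rank /endpt /=.
  rewrite !inversions_cat => <- <-; clear.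
  move: (count_mem East A) (count_mem North A) => eA nA.
  by move: (count_mem East B) (count_mem North B) => eB nB; nia.
(* This increment, times [k], is the term [n' * k] in the bounce formula. *)
have binn : 'C(n, 2) = ('C(n', 2) + n')%N.
  by have -> : n = n'.+1; [lia | rewrite binS bin1].
by rewrite /cobounce -hm -hm'; split; nia.
Qed.
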